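(* Let $l\in\mathbb{Z}^+$, and let $\lambda_s\in\mathbb{C}\setminus\{0\}$, $\vec a_s\in\mathbb{Z}^l$ and $\vec n_s\in(\mathbb{Z}^+)^l$ for $s=1,\ldots,k$. Suppose that all those moduli $\vec n_s$ which are maximal with respect to divisibility are distinct (i.e. if $\vec n_r$ is maximal with respect to divisibility among $\vec n_1,\ldots,\vec n_k$, then $\vec n_s\neq\vec n_r$ for all $s\neq r$). Let $\vec n_0\in(\mathbb{Z}^+)^l$. Then the function $w:\mathbb{Z}^l\to\mathbb{C}$ given by $$w(\vec x)=\sum_{s=1}^k\lambda_s[\![\vec n_s\mid\vec x-\vec a_s]\!]$$ is periodic modulo $\vec n_0$ if and only if $\vec n_0$ is divisible by all the moduli $\vec n_1,\ldots,\vec n_k$.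
   Context: $\mathbb{Z}^+=\{1,2,3,\ldots\}$. $\mathbb{Z}^l$ is the direct sum of $l$ copies of the ring $\mathbb{Z}$; for $\vec x,\vec y\in\mathbb{Z}^l$, $\vec x\mid\vec y$ means that $\vec y=\langle q_1x_1,\ldots,q_lx_l\rangle$ for some $\vec q\in\mathbb{Z}^l$ (componentwise divisibility). A modulus $\vec n_r$ is maximal with respect to divisibility if $\vec n_r\mid\vec n_s$ with $1\le s\le k$ implies $\vec n_s=\vec n_r$. A function $\Psi:\mathbb{Z}^l\to\mathbb{C}$ is periodic modulo $\vec n\in\mathbb{Z}^l$ if $\Psi(\vec x)=\Psi(\vec y)$ whenever $\vec n\mid\vec x-\vec y$. For an assertion $P$, $[\![P]\!]=1$ if $P$ holds and $0$ otherwise. *)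

(* Defs.v *)
From HB Require Import structures.
From mathcomp Require Import all_boot all_order all_algebra.
From mathcomp Require Import boolp reals.
From mathcomp.real_closed Require Import complex.
Set Implicit Arguments.
Unset Strict Implicit.
Unset Printing Implicit Defensive.
Import Order.TTheory GRing.Theory Num.Theory.
Local Open Scope ring_scope.

(* Divisibility in the product ring Z^l: row vectors are multiplied
   coordinate by coordinate. *)
Definition dvdv (l : nat) (x y : 'rV[int]_l) : Prop :=
  exists q : 'rV[int]_l, y = \row_j (q 0 j * x 0 j).

Definition maximal_modulus (l k : nat) (n : 'I_k -> 'rV[int]_l) (r : 'I_k) :
    Prop :=
  forall s : 'I_k, dvdv (n r) (n s) -> n s = n r.

Definition periodic_mod (l : nat) (T : Type) (Psi : 'rV[int]_l -> T)
    (m : 'rV[int]_l) : Prop :=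
  forall x y : 'rV[int]_l, dvdv m (x - y) -> Psi x = Psi y.

Definition iverson (K : pzSemiRingType) (P : Prop) : K :=
  if `[< P >] then 1 else 0.

Definition weighted_sum (R : realType) (l k : nat) (lambda : 'I_k -> R[i])
    (a n : 'I_k -> 'rV[int]_l) (x : 'rV[int]_l) : R[i] :=
  \sum_(s < k) lambda s * iverson R[i] (dvdv (n s) (x - a s)).

(* Main.v *)
Require Import Defs.
From HB Require Import structures.
From mathcomp Require Import all_boot all_order all_algebra.
From mathcomp Require Import cyclic separable cyclotomic.
From mathcomp Require Import boolp reals.
From mathcomp.real_closed Require Import complex.
Set Implicit Arguments.
Unset Strict Implicit.
Unset Printing Implicit Defensive.
Import Order.TTheory GRing.Theory Num.Theory.
Local Open Scope ring_scope.

(** That divisibility by every modulus forces periodicity is immediate, since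
    each summand is then periodic modulo [n0].  The converse is Fourier
    analysis on a finite quotient of Z^l.

    Every modulus divides a maximal one ([exists_maximal_modulus]), so let
    [m = n r] be maximal and consider the character
    chi(x) = prod_j z_j ^ x_j, where z_j is a primitive root of unity of order
    m_j.  Choose N such that [w], its summands and chi are periodic modulo N + 1
    in each coordinate, and sum g * chi over the box {0, ..., N}^l, for any g
    with that periodicity.  If [h] is a period of g, then translating the box
    by [h] shows that this sum equals chi(h) times itself
    ([fourier_period_eigen]), so it vanishes unless chi is trivial on all
    vectors divisible by [h], that is, unless [m] divides [h]
    ([fourier_neq0_dvdv]).

    Applied to the s-th summand of [w], this kills all terms with [n s] not
    divisible by [m]; by maximality and distinctness only the term s = r is
    left, and its sum is a positive multiple of a value of chi
    ([fourier_residue_class_neq0]).  Hence the sum for [w] does not vanish, and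
    the same principle applied to the period [n0] of [w] gives that [m]
    divides [n0]. *)

(** * Coordinatewise divisibility *)

Lemma dvdvP (l : nat) (x y : 'rV[int]_l) :
  dvdv x y <-> forall j, (x 0%R j %| y 0%R j)%Z.
Proof.
split=> [[q ->] j | dvd_xy]; first by rewrite mxE dvdz_mull.
exists (\row_j (y 0%R j %/ x 0%R j)%Z); apply/rowP => j.
by rewrite !mxE divzK.
Qed.

Lemma dvdv_trans (l : nat) (y x t : 'rV[int]_l) :
  dvdv x y -> dvdv y t -> dvdv x t.
Proof.
move=> /dvdvP xy /dvdvP yt; apply/dvdvP => j.
exact: dvdz_trans (xy j) (yt j).
Qed.

(** A modulus of largest coordinate sum among the multiples of [n s] is
    maximal: a proper multiple with positive coordinates has a strictly larger
    sum. *)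
Lemma exists_maximal_modulus (l k : nat) (n : 'I_k -> 'rV[int]_l)
    (n_gt0 : forall s j, 0 < n s 0 j) (s : 'I_k) :
  exists2 r, maximal_modulus n r & dvdv (n s) (n r).
Proof.
pose size_of (t : 'I_k) := (\sum_j `|n t 0%R j|)%N.
have ss : `[< dvdv (n s) (n s) >] by apply/asboolP/dvdvP => j.
case: (@arg_maxnP _ s (fun t => `[< dvdv (n s) (n t) >]) size_of ss).
move=> r /asboolP sr max_r; exists r => // t rt.
have : (size_of t <= size_of r)%N := max_r t (asboolT (dvdv_trans sr rt)).
have le_rt j : (`|n r 0%R j| <= `|n t 0%R j| ?= iff (`|n r 0%R j| == `|n t 0%R j|))%N.
  split=> //; apply: dvdn_leq; first by rewrite absz_gt0 gt_eqF.
  by move/dvdvP: rt => /(_ j); rewrite dvdzE.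
have := leqif_sum (fun j (_ : true) => le_rt j).
rewrite -/(size_of r) -/(size_of t) => le_size.
rewrite (geq_leqif le_size) => /forallP eq_abs.
apply/rowP => j; move/eqP: (eq_abs j) => /esym/(congr1 Posz).
by rewrite !gez0_abs ?ltW.
Qed.

(** * Periodic functions *)

Lemma periodic_modD (l : nat) (T : Type) (g : 'rV[int]_l -> T) h x :
  periodic_mod g h -> g (x + h) = g x.
Proof. by apply; rewrite addrC addKr; apply/dvdvP. Qed.

Lemma periodic_mod_dvdv (l : nat) (T : Type) (g : 'rV[int]_l -> T) m h :
  dvdv m h -> periodic_mod g m -> periodic_mod g h.
Proof. by move=> mh g_m x y /(dvdv_trans mh); apply: g_m. Qed.

Lemma periodic_residue_class (K : pzSemiRingType) (l : nat)
    (m a : 'rV[int]_l) :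
  periodic_mod (fun x => iverson K (dvdv m (x - a))) m.
Proof.
move=> x y /dvdvP xy; congr iverson; apply/propext.
have eq_dvd j : (m 0%R j %| (x - a) 0%R j)%Z = (m 0%R j %| (y - a) 0%R j)%Z.
  rewrite -(rpredDl ((y - a) 0 j) (xy j)).
  by congr (_ %| _)%Z; rewrite !mxE addrA subrK.
by split=> /dvdvP h; apply/dvdvP => j; rewrite ?eq_dvd // -eq_dvd.
Qed.

Lemma periodic_weighted_sum (R : realType) (l k : nat) (lambda : 'I_k -> R[i])
    (a n : 'I_k -> 'rV[int]_l) h :
  (forall s, dvdv (n s) h) -> periodic_mod (weighted_sum lambda a n) h.
Proof.
move=> n_h x y xy; apply: eq_bigr => s _; congr (_ * _).
exact: periodic_mod_dvdv (n_h s) (@periodic_residue_class _ _ _ (a s)) x y xy.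
Qed.

(** * Roots of unity and characters *)

(** When n is invertible, X^n - 1 is separable, so it has n distinct roots, and
    these form a cyclic group. *)
Lemma closed_prim_root_exists (F : closedFieldType) (n : nat) :
  n%:R != 0 :> F -> exists z : F, n.-primitive_root z.
Proof.
move=> n_neq0; pose p : {poly F} := 'X^n - 1.
have n_gt0 : (0 < n)%N by case: n n_neq0 {p} => //; rewrite eqxx.
have [r Dp] := closed_field_poly_normal p.
rewrite (monicP _) ?monicXnsubC // scale1r in Dp.
have rn1 : all n.-unity_root r.
  by apply/allP => z; rewrite -root_prod_XsubC -Dp.
have sz_r : (n < (size r).+1)%N.
  by rewrite -(size_prod_XsubC r id) -Dp size_XnsubC.
have uniq_r : uniq r.
  by rewrite -separable_prod_XsubC -Dp separable_Xn_sub_1.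
by have /hasP[z _ prim_z] := has_prim_root n_gt0 rn1 uniq_r sz_r; exists z.
Qed.

Lemma prim_root_exprz_eq1 (F : fieldType) (n : nat) (z : F) (c : int) :
  n.-primitive_root z -> (z ^ c == 1) = (n%:Z %| c)%Z.
Proof.
move=> prim_z; rewrite dvdzE /=.
case: c => c /=; first by rewrite (prim_order_dvd prim_z).
by rewrite NegzE -exprnN invr_eq1 (prim_order_dvd prim_z).
Qed.

Definition character (K : fieldType) (l : nat) (z : 'I_l -> K)
    (x : 'rV[int]_l) : K := \prod_j z j ^ x 0 j.

Section Character.

Variables (K : fieldType) (l : nat) (m : 'rV[int]_l) (z : 'I_l -> K).
Hypothesis prim_z : forall j, `|m 0%R j|%N.-primitive_root (z j).

Lemma character_base_neq0 j : z j != 0.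
Proof.
apply/eqP => z0; have := prim_expr_order (prim_z j).
by rewrite z0 expr0n gtn_eqF ?(prim_order_gt0 (prim_z j)) // => /esym/eqP;
  rewrite oner_eq0.
Qed.

Lemma characterD x y : character z (x + y) = character z x * character z y.
Proof.
rewrite -big_split; apply: eq_bigr => j _.
by rewrite mxE expfzDr ?character_base_neq0.
Qed.

Lemma character_neq0 x : character z x != 0.
Proof. by apply/prodf_neq0 => j _; rewrite expfz_neq0 ?character_base_neq0. Qed.

Lemma character_eq1 h : dvdv m h -> character z h = 1.
Proof.
move=> /dvdvP mh; apply: big1 => j _; apply/eqP.
by rewrite (prim_root_exprz_eq1 _ (prim_z j)) dvdzE /= -dvdzE.
Qed.

Lemma character_periodic : periodic_mod (character z) m.
Proof. by move=> x y xy; rewrite -(subrK y x) characterD character_eq1 ?mul1r. Qed.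

End Character.

(** * Summation over a box of residues *)

(** The box {0, ..., N}^l is encoded as the finite abelian group of row vectors
    over 'I_N.+1 with addition modulo N + 1, so that translations permute it;
    [box_lift] and [box_proj] are the section and the reduction modulo N + 1. *)
Definition box_lift (l N : nat) (x : 'rV['I_N.+1]_l) : 'rV[int]_l :=
  map_mx (fun i : 'I_N.+1 => i%:Z) x.

Definition box_proj (l N : nat) (h : 'rV[int]_l) : 'rV['I_N.+1]_l :=
  map_mx (fun c => inZp `|(c %% N.+1)%Z|%N) h.

Definition box_sum (K : nmodType) (l N : nat) (g : 'rV[int]_l -> K) : K :=
  \sum_(x : 'rV['I_N.+1]_l) g (box_lift x).

Lemma box_liftD_proj (l N : nat) (x : 'rV['I_N.+1]_l) h :
  dvdv (const_mx N.+1%:Z) (box_lift (x + box_proj N h) - (box_lift x + h)).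
Proof.
apply/dvdvP => j; rewrite !mxE /= -eqz_mod_dvd.
rewrite -!modz_nat PoszD modz_mod -modz_nat.
by rewrite gez0_abs ?modz_ge0 // modz_mod modzDmr.
Qed.

Lemma box_lift_proj (l N : nat) (h : 'rV[int]_l) :
  dvdv (const_mx N.+1%:Z) (box_lift (box_proj N h) - h).
Proof.
have := box_liftD_proj (0 : 'rV['I_N.+1]_l) h.
rewrite add0r; congr dvdv; apply/rowP => j; by rewrite !mxE add0r.
Qed.

(** Adding the reduction of [h] permutes the box and, modulo N + 1, agrees with
    adding [h], which is all that a function of period N + 1 can see. *)
Lemma box_sum_translate (K : nmodType) (l N : nat) (g : 'rV[int]_l -> K) h :
  periodic_mod g (const_mx N.+1%:Z) ->
  box_sum N (fun x => g (x + h)) = box_sum N g.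
Proof.
move=> g_N; rewrite [RHS](reindex_inj (addIr (box_proj N h))).
by apply: eq_bigr => x _; rewrite (g_N _ _ (box_liftD_proj x h)).
Qed.

(** * Fourier coefficients *)

Section Fourier.

Variables (K : fieldType) (l N : nat) (m : 'rV[int]_l) (z : 'I_l -> K).
Hypothesis prim_z : forall j, `|m 0%R j|%N.-primitive_root (z j).
Hypothesis m_N : dvdv m (const_mx N.+1%:Z).

(** Up to normalization, the Fourier coefficient of [g] at the inverse of the
    character. *)
Definition fourier (g : 'rV[int]_l -> K) : K :=
  box_sum N (fun x => g x * character z x).

Lemma fourier_sum k (lambda : 'I_k -> K) (g : 'I_k -> 'rV[int]_l -> K) :
  fourier (fun x => \sum_s lambda s * g s x) =
  \sum_s lambda s * fourier (g s).
Proof.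
under [RHS]eq_bigr do rewrite mulr_sumr.
rewrite exchange_big; apply: eq_bigr => x _ /=.
by rewrite mulr_suml; apply: eq_bigr => s _; rewrite mulrA.
Qed.

(** Translating the summation variable by [h] leaves [g] alone and takes the
    factor [character z h] out of the character. *)
Lemma fourier_period_eigen g h :
  periodic_mod g (const_mx N.+1%:Z) -> periodic_mod g h ->
  fourier g = character z h * fourier g.
Proof.
move=> g_N g_h; rewrite {1}/fourier -(box_sum_translate h); last first.
  move=> x y xy; rewrite (g_N x y xy); congr (_ * _).
  exact: periodic_mod_dvdv m_N (character_periodic prim_z) x y xy.
rewrite mulr_sumr; apply: eq_bigr => x _.
by rewrite (periodic_modD _ g_h) (characterD prim_z) mulrA mulrC.
Qed.

(** The period [h] is tested one coordinate at a time: the vector supported at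
    [j] with entry [h 0 j] is a multiple of [h], hence also a period, and the
    character takes the value [z j ^ h 0 j] there. *)
Lemma fourier_neq0_dvdv g h :
  periodic_mod g (const_mx N.+1%:Z) -> periodic_mod g h ->
  fourier g != 0 -> dvdv m h.
Proof.
move=> g_N g_h g_neq0; apply/dvdvP => j.
pose hj : 'rV[int]_l := \row_i (if i == j then h 0 i else 0).
have h_hj : dvdv h hj by apply/dvdvP => i; rewrite mxE; case: ifP.
have := fourier_period_eigen g_N (periodic_mod_dvdv h_hj g_h).
rewrite -[LHS]mul1r => /(mulIf g_neq0)/esym.
rewrite /character (bigD1 j) //= big1 ?mulr1 => [|i i_j]; last first.
  by rewrite mxE (negPf i_j) expr0z.
by rewrite mxE eqxx => /eqP; rewrite (prim_root_exprz_eq1 _ (prim_z j)) dvdzE.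
Qed.

End Fourier.

(** On the residue class of [a] modulo [m] the character is constant, so the
    coefficient is its value at [a] times the number of points of the class in
    the box; the class does meet the box because [m] divides [N.+1]. *)
Lemma fourier_residue_class_neq0 (K : numFieldType) (l N : nat)
    (m a : 'rV[int]_l) (z : 'I_l -> K) :
  (forall j, `|m 0%R j|%N.-primitive_root (z j)) ->
  dvdv m (const_mx N.+1%:Z) ->
  fourier N z (fun x => iverson K (dvdv m (x - a))) != 0.
Proof.
move=> prim_z m_N; rewrite /fourier /box_sum.
under eq_bigr => x _.
  have -> : iverson K (dvdv m (box_lift x - a)) * character z (box_lift x) =
            (`[< dvdv m (box_lift x - a) >] : nat)%:R * character z a.
    rewrite /iverson; case: asboolP => [xa|]; last by rewrite !mul0r.
    by rewrite (character_periodic prim_z xa).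
  over.
rewrite -mulr_suml mulf_neq0 ?(character_neq0 prim_z) //.
rewrite -natr_sum pnatr_eq0 sum_nat_eq0 negb_forall.
apply/existsP; exists (box_proj N a) => /=.
by rewrite (asboolT (dvdv_trans m_N (box_lift_proj N a))).
Qed.

Theorem corollary1p4 (R : realType) (l k : nat) (lambda : 'I_k -> R[i])
    (a n : 'I_k -> 'rV[int]_l) (n0 : 'rV[int]_l)
    (l_gt0 : (0 < l)%N)
    (lambda_neq0 : forall s : 'I_k, lambda s <> 0)
    (n_gt0 : forall (s : 'I_k) (j : 'I_l), 0 < n s 0 j)
    (max_distinct : forall r : 'I_k, maximal_modulus n r ->
       forall s : 'I_k, s <> r -> n s <> n r)
    (n0_gt0 : forall j : 'I_l, 0 < n0 0 j) :
  periodic_mod (weighted_sum lambda a n) n0 <->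
  (forall s : 'I_k, dvdv (n s) n0).
Proof.
split=> [w_n0 s | ]; last exact: periodic_weighted_sum.
have [r max_r sr] := exists_maximal_modulus n_gt0 s.
apply: dvdv_trans sr _.
(* A common period of all summands, of the form N.+1 in every coordinate. *)
pose P := (\prod_s \prod_j `|n s 0%R j|)%N.
have P_gt0 : (0 < P)%N.
  by do 2![apply: prodn_gt0 => ?]; rewrite absz_gt0 gt_eqF.
pose N := P.-1.
have n_N t : dvdv (n t) (const_mx N.+1%:Z).
  apply/dvdvP => j; rewrite mxE prednK // dvdzE /=.
  by rewrite /P (bigD1 t) //= dvdn_mulr // (bigD1 j) //= dvdn_mulr.
have /choice[z prim_z] j : exists y : R[i], `|n r 0%R j|%N.-primitive_root y.
  by apply: closed_prim_root_exists; rewrite pnatr_eq0 absz_eq0 gt_eqF.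
apply: (fourier_neq0_dvdv prim_z (n_N r) _ w_n0).
  exact: periodic_weighted_sum.
rewrite (fourier_sum N z lambda (fun s x => iverson _ (dvdv (n s) (x - a s)))).
rewrite (bigD1 r) //= big1 => [|t t_r].
  rewrite addr0 mulf_neq0 ?(fourier_residue_class_neq0 _ prim_z) //.
  exact/eqP.
(* A nonzero coefficient makes [n t] a multiple of the maximal [n r], hence
   equal to it, against the distinctness of [n r]. *)
set g := (X in fourier N z X).
have g_t : periodic_mod g (n t) := @periodic_residue_class _ _ _ _.
have [->|g_neq0] := eqVneq (fourier N z g) 0; first by rewrite mulr0.
have rt := fourier_neq0_dvdv prim_z (n_N r) (periodic_mod_dvdv (n_N t) g_t)
  g_t g_neq0.
by case: (max_distinct r max_r t (elimN eqP t_r) (max_r t rt)).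
Qed.
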